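(* Let $L$ be an $11$-colorable link with non-zero determinant. If some diagram of $L$ can be non-trivially $11$-colored with colors from a color set $S\subseteq\mathbb{Z}_{11}$ with $|S|=5$, then $S$ is equivalent mod $11$ to $\{0,1,2,3,6\}$ or to $\{0,1,2,4,7\}$.
   Context: Links are classical links in 3-space. For an integer $m>1$, a (Fox) $m$-coloring of a link diagram is an assignment of elements (''colors'') of $\mathbb{Z}_m=\{0,1,\ldots,m-1\}$ to the arcs of the diagram such that at each crossing twice the color of the over-arc equals the sum of the colors of the two under-arcs modulo $m$. A coloring is non-trivial if it uses at least two distinct colors. A link is $m$-colorable if it has a diagram with a non-trivial $m$-coloring (equivalently, every diagram of it has one). An $m$-coloring automorphism is a permutation $f$ of $\mathbb{Z}_m$ such that $f(a\ast b)=f(a)\ast f(b)$ for all $a,b\in\mathbb{Z}_m$, where $x\ast y=2y-x \pmod m$; these are exactly the maps $f_{\lambda,\mu}(x)=\lambda x+\mu$ with $\mu\in\mathbb{Z}_m$ and $\lambda$ a unit of $\mathbb{Z}_m$. Two color sets (subsets of $\mathbb{Z}_m$) $S_1,S_2$ are equivalent mod $m$ if there is an $m$-coloring automorphism $f_{\lambda,\mu}$ with $f_{\lambda,\mu}(S_1)=S_2$. *)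

(* Defs.v *)
(* The classical [asbool] is only used to form the quotient type of links. *)
From HB Require Import structures.
From mathcomp Require Import all_boot all_order all_algebra.
From mathcomp Require Import perm boolp.
From Stdlib Require Import Relation_Operators.

Set Implicit Arguments.
Unset Strict Implicit.
Unset Printing Implicit Defensive.

Import GRing.Theory.
Local Open Scope quotient_scope.

(* Links are handled through their planar diagrams modulo Reidemeister moves.
   A diagram is in Morse position with respect to the height function of the
   plane: it is cut by horizontal lines into slices, read from bottom to top,
   each containing exactly one local minimum [Cup], local maximum [Cap] or
   crossing [Cross], all other strands being vertical.  Every link diagram has
   this form up to planar isotopy.  On each horizontal line the strands are
   numbered 0, 1, 2, ... from left to right.
   - [Cup i] creates the strands i and i+1 of the line above it;
   - [Cap i] joins the strands i and i+1 of the line below it;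
   - [Cross b i] makes the strands i and i+1 cross; if [b] is true, the
     over-strand runs from i (below) to i+1 (above), and if [b] is false it runs
     from i+1 (below) to i (above). *)
Inductive slice := Cup of nat | Cap of nat | Cross of bool & nat.

Definition slice_code (s : slice) : (nat + nat) + (bool * nat) :=
  match s with
  | Cup i => inl (inl i)
  | Cap i => inl (inr i)
  | Cross b i => inr (b, i)
  end.

Definition slice_decode (c : (nat + nat) + (bool * nat)) : slice :=
  match c with
  | inl (inl i) => Cup i
  | inl (inr i) => Cap i
  | inr (b, i) => Cross b i
  end.

Lemma slice_codeK : cancel slice_code slice_decode.
Proof. by case. Qed.

HB.instance Definition _ := Countable.copy slice (can_type slice_codeK).

Definition leftmost (s : slice) : nat :=
  match s with Cup i | Cap i | Cross _ i => i end.

Definition arity_in (s : slice) : nat := if s is Cup _ then 0 else 2.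

Definition arity_out (s : slice) : nat := if s is Cap _ then 0 else 2.

Definition move_to (j : nat) (s : slice) : slice :=
  match s with
  | Cup _ => Cup j
  | Cap _ => Cap j
  | Cross b _ => Cross b j
  end.

Definition width_above (n : nat) (s : slice) : nat :=
  n - arity_in s + arity_out s.

Definition width (w : seq slice) : nat := foldl width_above 0 w.

Fixpoint closes (n : nat) (w : seq slice) : bool :=
  if w is s :: w' then
    (leftmost s + arity_in s <= n) && closes (width_above n s) w'
  else n == 0.

(* A link has at least one component, hence the exclusion of the empty word. *)
Definition is_diagram (w : seq slice) : bool := (w != [::]) && closes 0 w.

Definition diagram := {w : seq slice | is_diagram w}.

(* Local moves, to be applied in both directions.  [Exchange], [Zigzag*] and
   [Slide*] (a crossing passes through a local extremum of one of its two
   strands) generate the planar isotopies between Morse diagrams; [R1*], [R2],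
   [R3] are the Reidemeister moves.  A curl on an
   upward strand is removed by a slide, [R1*] and a zigzag.  In [R3] the strands
   entering at i, i+1, i+2 are x, y, z, and [bxy] (resp. [bxz], [byz]) says that
   x is over y (resp. x over z, y over z); the side condition excludes the two
   cyclic patterns, in which no strand can be moved across. *)
Inductive local_move : seq slice -> seq slice -> Prop :=
| Exchange s t of leftmost s + arity_out s <= leftmost t :
    local_move [:: s; t]
      [:: move_to (leftmost t - arity_out s + arity_in s) t; s]
| ZigzagL i : local_move [:: Cup i.+1; Cap i] [::]
| ZigzagR i : local_move [:: Cup i; Cap i.+1] [::]
| SlideCup b i :
    local_move [:: Cup i; Cross b i.+1] [:: Cup i.+1; Cross (~~ b) i]
| SlideCap b i :
    local_move [:: Cross b i.+1; Cap i] [:: Cross (~~ b) i; Cap i.+1]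
| R1Cup b i : local_move [:: Cup i; Cross b i] [:: Cup i]
| R1Cap b i : local_move [:: Cross b i; Cap i] [:: Cap i]
| R2 b i : local_move [:: Cross b i; Cross (~~ b) i] [::]
| R3 bxy bxz byz i of (bxy == byz) ==> (bxz == bxy) :
    local_move [:: Cross bxy i; Cross bxz i.+1; Cross byz i]
               [:: Cross byz i.+1; Cross bxz i; Cross bxy i.+1].

Definition diagram_move (D E : diagram) : Prop :=
  exists u v a b : seq slice,
    [/\ local_move a b, val D = u ++ a ++ v & val E = u ++ b ++ v].

Definition isotopic (D E : diagram) : bool :=
  `[< clos_refl_sym_trans diagram diagram_move D E >].

Lemma isotopic_refl : reflexive isotopic.
Proof. by move=> D; apply/asboolP; exact: rst_refl. Qed.

Lemma isotopic_sym : symmetric isotopic.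
Proof.
by move=> D E; apply/asboolP/asboolP; exact: rst_sym.
Qed.

Lemma isotopic_trans : transitive isotopic.
Proof.
move=> E D F /asboolP DE /asboolP EF; apply/asboolP.
exact: rst_trans DE EF.
Qed.

Canonical isotopic_equiv :=
  EquivRel isotopic isotopic_refl isotopic_sym isotopic_trans.

(* By Reidemeister's theorem, ambient isotopy classes of classical (unoriented)
   links in 3-space. *)
Definition link := {eq_quot isotopic}.

Definition diagram_of (D : diagram) (L : link) : Prop := \pi_link D = L.

(* The points where the diagram meets the horizontal lines: the k-th line has
   the first k slices below it. *)
Definition point (D : diagram) :=
  {k : 'I_(size (val D)).+1 & 'I_(width (take k (val D)))}.

Definition line D (x : point D) : nat := tag x.

Definition place D (x : point D) : nat := tagged x.

Definition slice_at (D : diagram) (k : nat) : slice := nth (Cup 0) (val D) k.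

(* The boundary points of a slice are encoded as pairs [(t, p)], where [t] tells
   whether the point lies on the line above the slice and [p] is its place. *)
Definition boundary := (bool * nat)%type.

Definition over_in (b : bool) (i : nat) : boundary := (false, i + ~~ b).
Definition over_out (b : bool) (i : nat) : boundary := (true, i + b).
Definition under_in (b : bool) (i : nat) : boundary := (false, i + b).
Definition under_out (b : bool) (i : nat) : boundary := (true, i + ~~ b).

(* The two boundary points are the ends of a strand of the slice that is not the
   under-strand of a crossing; the first two disjuncts are the vertical strands
   to the left and to the right. *)
Definition slice_joins (s : slice) (x y : boundary) : bool :=
  [|| [&& ~~ x.1, y.1, x.2 < leftmost s & y.2 == x.2],
      [&& ~~ x.1, y.1, leftmost s + arity_in s <= x.2
        & y.2 + arity_in s == x.2 + arity_out s]
    | match s with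
      | Cup i => (x == (true, i)) && (y == (true, i.+1))
      | Cap i => (x == (false, i)) && (y == (false, i.+1))
      | Cross b i => (x == over_in b i) && (y == over_out b i)
      end].

Definition lies_at D (k : nat) (x : point D) (e : boundary) : bool :=
  (line x == k + e.1) && (place x == e.2).

Definition adjacent D (x y : point D) : bool :=
  [exists k : 'I_(size (val D)),
    [&& k <= line x <= k.+1, k <= line y <= k.+1
      & slice_joins (slice_at D k) (line x == k.+1, place x)
                                   (line y == k.+1, place y)]].

Definition same_strand D : rel (point D) :=
  fun x y => adjacent x y || adjacent y x.

Lemma same_strand_connect_sym D : connect_sym (@same_strand D).
Proof. by apply: sym_connect_sym => x y; rewrite /same_strand orbC. Qed.

(* The arcs, i.e. the maximal curves of the diagram that do not pass under a
   crossing, each given by a representative point. *)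
Definition diagram_arc (D : diagram) := {x : point D | roots (@same_strand D) x}.

Definition arc_through D (x : point D) : diagram_arc D :=
  Sub (fingraph.root (@same_strand D) x)
      (roots_root (@same_strand_connect_sym D) x).

(* A crossing is given by a point of its over-strand (below it) and the points
   of its under-strand below and above it. *)
Definition is_crossing D (t : point D * point D * point D) : bool :=
  [exists k : 'I_(size (val D)),
    if slice_at D k is Cross b i then
      [&& lies_at k t.1.1 (over_in b i), lies_at k t.1.2 (under_in b i)
        & lies_at k t.2 (under_out b i)]
    else false].

Definition crossing (D : diagram) :=
  {t : point D * point D * point D | is_crossing t}.

Definition over_arc D (t : crossing D) : diagram_arc D :=
  arc_through (val t).1.1.
Definition under_arc1 D (t : crossing D) : diagram_arc D :=
  arc_through (val t).1.2.
Definition under_arc2 D (t : crossing D) : diagram_arc D :=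
  arc_through (val t).2.

Local Open Scope ring_scope.

(* ['Z_m] is the ring of integers mod m only for m > 1. *)
Definition coloring (m : nat) (D : diagram) (c : diagram_arc D -> 'Z_m) :
  Prop :=
  forall t : crossing D,
    2%:R * c (over_arc t) = c (under_arc1 t) + c (under_arc2 t).

Definition nontrivial (m : nat) (D : diagram) (c : diagram_arc D -> 'Z_m) :
  Prop :=
  exists a b : diagram_arc D, c a <> c b.

Definition colorable (m : nat) (L : link) : Prop :=
  exists2 D : diagram, diagram_of D L
    & exists2 c : diagram_arc D -> 'Z_m, coloring c & nontrivial c.

Definition coloring_matrix (D : diagram) :
    'M[int]_(#|{: crossing D}|, #|{: diagram_arc D}|) :=
  \matrix_(i, j)
    let t := enum_val i in let a := enum_val j in
    (a == over_arc t)%:R *+ 2 - (a == under_arc1 t)%:R - (a == under_arc2 t)%:R.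

(* The gcd of all minors of order (number of arcs) - 1 of the coloring matrix.
   When there are as many crossings as arcs, these minors all have the same
   absolute value, the usual determinant; taking the gcd also covers diagrams
   having arcs that are closed curves (value 1 for a circle without crossings,
   and 0 for all other such diagrams).  Repeated rows or columns, allowed here,
   only contribute zero minors. *)
Definition diagram_det (D : diagram) : nat :=
  let n := #|{: diagram_arc D}| in
  \big[gcdn/0%N]_(f : {ffun 'I_n.-1 -> 'I_#|{: crossing D}|})
  \big[gcdn/0%N]_(g : {ffun 'I_n.-1 -> 'I_n})
    `|\det (mxsub f g (coloring_matrix D))|%N.

(* [diagram_det] is a link invariant, so the choice of the diagram [repr L] of
   [L] is immaterial. *)
Definition link_det (L : link) : nat := diagram_det (repr L).

Definition quandle_op (m : nat) (x y : 'Z_m) : 'Z_m := 2%:R * y - x.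

Definition coloring_automorphism (m : nat) (f : {perm 'Z_m}) : Prop :=
  forall a b : 'Z_m, f (quandle_op a b) = quandle_op (f a) (f b).

Definition equivalent_color_sets (m : nat) (S1 S2 : {set 'Z_m}) : Prop :=
  exists2 f : {perm 'Z_m}, coloring_automorphism f & f @: S1 = S2.

(* Main.v *)
Require Import Defs.
From mathcomp Require Import all_boot all_order all_algebra.
From mathcomp Require Import perm boolp zify ring.

(** Suppose that some diagram of [L] has an integer coloring that is not
    constant.  Reidemeister moves transport such colorings, so every diagram of
    [L] has one; the coloring matrix over the integers then has, besides the
    constants, another vector in its kernel, all its minors of order (number of
    arcs) - 1 vanish, and the determinant of [L] is zero.

    Up to affine maps, there are six 5-subsets of Z/11.  On each of them except
    {0,1,2,3,6} and {0,1,2,4,7}, there is an injective map to the integers that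
    preserves every relation 2y = x + z holding modulo 11 in the subset.  Hence a
    non-trivial 11-coloring by such a subset lifts to a non-constant integer
    coloring, which is impossible when the determinant is not zero. *)

Set Implicit Arguments.
Unset Strict Implicit.
Unset Printing Implicit Defensive.

Import GRing.Theory Num.Theory.
Local Open Scope ring_scope.
Local Open Scope quotient_scope.

(** * Integer colorings as runs of a diagram *)

Definition cross_colors (b : bool) (x y : int) : seq int :=
  if b then [:: 2 * x - y; x] else [:: y; 2 * y - x].

Definition local_coloring (s : slice) (p q : seq int) : Prop :=
  match s with
  | Cup _ => exists x, p = [::] /\ q = [:: x; x]
  | Cap _ => exists x, p = [:: x; x] /\ q = [::]
  | Cross b _ => exists x y, p = [:: x; y] /\ q = cross_colors b x y
  end.

(* A state lists, from left to right, the colors of the strands that cross a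
   horizontal line; a step passes from the line below a slice to the line above
   it. *)
Definition step (s : slice) (st st' : seq int) : Prop :=
  exists u v p q, [/\ size u = leftmost s, local_coloring s p q,
    st = u ++ p ++ v & st' = u ++ q ++ v].

Definition is_cup (s : slice) : bool := if s is Cup _ then true else false.

Definition is_cap (s : slice) : bool := if s is Cap _ then true else false.

(* [ss] lists the states above the successive slices of [w], [st] being the state
   below the first one. *)
Fixpoint run (st : seq int) (w : seq slice) (ss : seq (seq int)) : Prop :=
  match w, ss with
  | [::], [::] => True
  | s :: w', st' :: ss' => step s st st' /\ run st' w' ss'
  | _, _ => False
  end.

Definition constant_states (k : int) : pred (seq (seq int)) :=
  all (all (pred1 k)).

(** One value [k] must serve for all heights together: with two circles drawn one above the other,
    every single state may be constant although the coloring is not. *)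
Definition has_nonconstant_run (w : seq slice) : Prop :=
  exists2 ss, run [::] w ss & forall k, ~~ constant_states k ss.

Lemma run_cat st w1 w2 ss : run st (w1 ++ w2) ss <->
  exists ss1 ss2, [/\ ss = ss1 ++ ss2, run st w1 ss1
    & run (last st ss1) w2 ss2].
Proof.
elim: w1 st ss => [|s w1 IH] st ss /=.
  split=> [r|]; first by exists [::], ss.
  by case=> [[|? ?]] [ss2] [-> //].
case: ss => [|st' ss]; first by split=> // -[[|? ?]] [? []].
split.
  case=> ss' /IH [ss1] [ss2] [-> r1 r2].
  by exists (st' :: ss1), ss2.
case=> [[|st1 ss1]] [ss2] [] //= [<- ->] [s1 r1] r2; split=> //.
by apply/IH; exists ss1, ss2.
Qed.

Lemma local_coloring_size s p q : local_coloring s p q ->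
  size p = arity_in s /\ size q = arity_out s.
Proof.
case: s => [i|i|b i] /=; [case=> x | case=> x | case=> x [y]] => -[-> ->] //.
by case: b.
Qed.

Lemma local_coloring_move_to j s p q :
  local_coloring s p q -> local_coloring (move_to j s) p q.
Proof. by case: s. Qed.

Lemma leftmost_move_to j s : leftmost (move_to j s) = j.
Proof. by case: s. Qed.

Lemma step_cat u v p q s : size u = leftmost s -> local_coloring s p q ->
  step s (u ++ p ++ v) (u ++ q ++ v).
Proof. by move=> *; exists u, v, p, q. Qed.

Lemma cat_inj_size (T : eqType) (u u' v v' : seq T) :
  size u = size u' -> u ++ v = u' ++ v' -> u = u' /\ v = v'.
Proof. by move=> su /eqP; rewrite eqseq_cat // => /andP[/eqP-> /eqP->]. Qed.

Lemma cat_split (T : Type) (u u' v v' : seq T) :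
  (size u <= size u')%N -> u ++ v = u' ++ v' ->
  exists2 m, u' = u ++ m & v = m ++ v'.
Proof.
elim: u u' => [|x u IH] [|y u'] //=; first by move=> _ ->; exists [::].
  by move=> _ ->; exists (y :: u').
by move=> /IH {}IH [<- /IH[m -> ->]]; exists m.
Qed.

(** * Rigidity of the local moves *)

Lemma step_constant s st st' k : ~~ is_cup s ->
  step s st st' -> all (pred1 k) st -> all (pred1 k) st'.
Proof.
move=> ns [u] [v] [p] [q] [_ l -> ->]; rewrite !all_cat.
case/and3P=> -> pk ->; rewrite andbT /=.
case: s ns l => [i|i|b i] //= _; first by case=> x [_ ->].
case=> x [y] [ep ->]; move: pk; rewrite ep /=.
by case: b => /and3P[/eqP-> /eqP-> _] /=; rewrite andbT; lia.
Qed.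

(** Read downwards, only a cap can bring in a new color: at a crossing, [2 * x - y = k] and [x = k]
    force [y = k]. *)
Lemma step_constant_rev s st st' k : ~~ is_cap s ->
  step s st st' -> all (pred1 k) st' -> all (pred1 k) st.
Proof.
move=> ns [u] [v] [p] [q] [_ l -> ->]; rewrite !all_cat.
case/and3P=> -> pk ->; rewrite andbT /=.
case: s ns l => [i|i|b i] //= _; first by case=> x [-> _].
case=> x [y] [-> ep]; move: pk; rewrite ep /=.
by case: b ep => _ /=; lia.
Qed.

(** When [i] and [j] differ, the cap does not absorb both ends of the cup, so one of them survives
    in [st2] and the new arc has color [k]. For [i = j] the two slices would form a closed circle,
    of arbitrary color. *)
Lemma cup_cap_constant i j st st1 st2 k : i <> j ->
  step (Cup i) st st1 -> step (Cap j) st1 st2 ->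
  all (pred1 k) st -> all (pred1 k) st2 -> all (pred1 k) st1.
Proof.
move=> nij [u] [v] [p] [q] [/= su [x [-> ->]] -> ->].
move=> [u'] [v'] [p'] [q'] [/= su' [y [-> ->]] e ->].
rewrite e !all_cat /= => /andP[uk vk] /andP[u'k v'k].
rewrite u'k v'k !andbT /=.
suff xk : x == k.
  have : all (pred1 k) (u ++ [:: x, x & v]) by rewrite all_cat /= uk xk vk.
  by rewrite e all_cat /= => /and4P[_ ->].
have [lt|gt|//] := ltngtP i j.
  have := cat_split (_ : size u <= size u')%N e.
  case=> [|[|z m] eu' [ez _]]; first lia.
    by exfalso; move: lt; rewrite -su -su' eu' cats0 ltnn.
  by move: u'k; rewrite eu' ez all_cat /= => /and3P[].
(* The cap is now on the left and [m] has length [i - j]. If this is 1, the cap absorbs the left end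
   of the cup and the right end survives; otherwise both survive. *)
have /esym e' := e; have := cat_split (_ : size u' <= size u)%N e'.
case=> [|m eu em]; first lia.
case: m em eu => [|z [|z' m]] em eu.
- by exfalso; move: gt; rewrite -su -su' eu cats0 ltnn.
- by case: em => _ _ ev'; move: v'k; rewrite ev' /= => /andP[].
by case: em => _ _ ev'; move: v'k; rewrite ev' all_cat /= => /and3P[].
Qed.

(* Both sides of every local move are rigid; therefore a move cannot turn a
   non-constant coloring into a constant one. *)
Definition rigid (w : seq slice) : Prop := forall st ss k, run st w ss ->
  all (pred1 k) st -> all (pred1 k) (last st ss) -> constant_states k ss.

(** The only state to control is the middle one. It is constant by propagation from below unless [s]
    is a cup, and from above unless [t] is a cap. *)
Lemma rigid2 s t :
  (if (s, t) is (Cup i, Cap j) then i != j else true) -> rigid [:: s; t].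
Proof.
move=> st0 st [|st1 [|st2 [|? ?]]] k //=; try by case=> ? [].
case=> s1 [s2 _] k0 k2; rewrite k2 !andbT.
have [/step_constant|] := boolP (~~ is_cup s).
  by apply; eauto.
have [/step_constant_rev H _|] := boolP (~~ is_cap t).
  by apply: H s2 k2.
case: t s2 st0 => // j s2 st0 _; case: s s1 st0 => // i s1 /eqP st0 _.
exact: cup_cap_constant st0 s1 s2 k0 k2.
Qed.

Lemma rigid_small w : (size w <= 1)%N -> rigid w.
Proof.
case: w => [|s [|? ?]] // _ st [|st1 [|? ?]] k //=; try tauto.
by move=> _ _; rewrite !andbT => ->.
Qed.

Lemma rigid_cross3 a b c i j l : rigid [:: Cross a i; Cross b j; Cross c l].
Proof.
move=> st [|st1 [|st2 [|st3 [|? ?]]]] k //=; try tauto.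
case=> s1 [s2 _] k0 k3; rewrite k3 andbT /=.
have k1 := step_constant (isT : ~~ is_cup (Cross a i)) s1 k0.
have k2 := step_constant (isT : ~~ is_cup (Cross b j)) s2 k1.
by rewrite k1 k2.
Qed.

Lemma local_move_rigid a b : local_move a b -> rigid a /\ rigid b.
Proof.
case=> {a b} [s t le|i|i|b i|b i|b i|b i|b i|bxy bxz byz i _];
  split; try (by apply: rigid_small); try (by apply: rigid_cross3);
  apply: rigid2 => //; try lia.
- by case: s t le => [i|i|b i] [j|j|c j] //=; lia.
- by case: s t le => [i|i|b i] [j|j|c j] //=; lia.
Qed.

(** * Transport of runs across local moves *)

Fixpoint fits (n : nat) (w : seq slice) : bool :=
  if w is s :: w' then
    (leftmost s + arity_in s <= n)%N && fits (width_above n s) w'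
  else true.

(* The assumption [fits] matters when [a] is empty, as the run of [a] then gives no
   lower bound on the number of strands. *)
Definition simulates (a b : seq slice) : Prop := forall st ss,
  fits (size st) b -> run st a ss ->
  exists2 ss', run st b ss' & last st ss' = last st ss.

Lemma cat_align_succ (T : eqType) (u u' v v' : seq T) :
  size u' = (size u).+1 -> u ++ v = u' ++ v' ->
  exists2 x, u' = rcons u x & v = x :: v'.
Proof.
move=> su e; have [|m eu ev] := cat_split _ e; first by rewrite su.
move: su ev; rewrite eu size_cat -addn1; case: m eu => [|x [|? ?]] eu /=; try lia.
by move=> _ ->; exists x => //; rewrite cats1.
Qed.

(** The two slices act on disjoint blocks: the state is cut as [u ++ p ++ m ++ p' ++ v'], where [s]
    changes [p] and [t] changes [p'], in either order. *)
Lemma exchange_simulates s t : (leftmost s + arity_out s <= leftmost t)%N ->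
  simulates [:: s; t]
    [:: move_to (leftmost t - arity_out s + arity_in s) t; s].
Proof.
move=> le st [|st1 [|st2 [|? ?]]] // _; try by move=> /=; tauto.
case=> [[u] [v] [p] [q] [su l -> ->]] [[u'] [v'] [p'] [q'] [su' l' e ->] _].
have [sp sq] := local_coloring_size l.
have [||m eu' ev] := @cat_split _ (u ++ q) u' v (p' ++ v').
- by rewrite size_cat su sq su'.
- by rewrite -catA.
subst u' v; exists [:: u ++ p ++ m ++ q' ++ v'; u ++ q ++ m ++ q' ++ v'].
  split; last by split=> //; apply: step_cat.
  rewrite !(catA u) !(catA (u ++ p)); apply: step_cat.
    by rewrite leftmost_move_to; move: su'; rewrite !size_cat sp sq su; lia.
  exact: local_coloring_move_to.
by rewrite /= -!catA.
Qed.

Lemma exchange_simulates_rev s t : (leftmost s + arity_out s <= leftmost t)%N ->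
  simulates [:: move_to (leftmost t - arity_out s + arity_in s) t; s]
    [:: s; t].
Proof.
move=> le st [|st1 [|st2 [|? ?]]] // _; try by move=> /=; tauto.
case=> [[u'] [v'] [p'] [q'] [su' l' -> ->]] [[u] [v] [p] [q] [su l e ->] _].
have [sp sq] := local_coloring_size l.
move: su'; rewrite leftmost_move_to => su'.
have {}l' : local_coloring t p' q' by move: l'; case: (t).
have [||m eu' ev] := @cat_split _ (u ++ p) u' v (q' ++ v').
- by rewrite size_cat su sp su'; lia.
- by rewrite -catA.
subst u' v; exists [:: u ++ q ++ m ++ p' ++ v'; u ++ q ++ m ++ q' ++ v'] => //.
split; first by rewrite -!catA; apply: step_cat.
split=> //; rewrite !(catA u) !(catA (u ++ q)); apply: step_cat => //.
by move: su'; rewrite !size_cat sp sq su; lia.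
Qed.

(** The cap identifies the color of the cup with that of the strand next to it, so the strand leaves
    the zigzag with the color it had. *)
Lemma zigzagL_simulates i : simulates [:: Cup i.+1; Cap i] [::].
Proof.
move=> st [|st1 [|st2 [|? ?]]] // _; try by move=> /=; tauto.
case=> [[u] [v] [p] [q] [/= su [x [-> ->]] -> ->]].
case=> [[u'] [v'] [p'] [q'] [/= su' [y [-> ->]] e ->] _].
have [|z -> [<- -> ->]] := cat_align_succ _ (esym e); first by rewrite su su'.
by exists [::] => //=; rewrite cat_rcons.
Qed.

Lemma zigzagR_simulates i : simulates [:: Cup i; Cap i.+1] [::].
Proof.
move=> st [|st1 [|st2 [|? ?]]] // _; try by move=> /=; tauto.
case=> [[u] [v] [p] [q] [/= su [x [-> ->]] -> ->]].
case=> [[u'] [v'] [p'] [q'] [/= su' [y [-> ->]] e ->] _].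
have [|z -> [<- -> ->]] := cat_align_succ _ e; first by rewrite su su'.
by exists [::] => //=; rewrite cat_rcons.
Qed.

Lemma step_cross b i u v x y : size u = i ->
  step (Cross b i) (u ++ [:: x, y & v]) (u ++ cross_colors b x y ++ v).
Proof. by move=> su; apply: (@step_cat u v [:: x; y]) => //; exists x, y. Qed.

Lemma step_crossS b i u v x y z : size u = i ->
  step (Cross b i.+1) (u ++ [:: z, x, y & v])
    (u ++ z :: cross_colors b x y ++ v).
Proof.
by move=> su; rewrite -!(cat_rcons z); apply: step_cross; rewrite size_rcons su.
Qed.

Lemma step_cross_inv b i st st' : step (Cross b i) st st' ->
  exists u v x y, [/\ size u = i, st = u ++ [:: x, y & v]
    & st' = u ++ cross_colors b x y ++ v].
Proof.
by case=> u [v] [p] [q] [su [x [y [-> ->]]] -> ->]; exists u, v, x, y.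
Qed.

Lemma step_cross_inv_cat b i u st st' : size u = i ->
  step (Cross b i) (u ++ st) st' ->
  exists v x y, st = [:: x, y & v] /\ st' = u ++ cross_colors b x y ++ v.
Proof.
move=> su /step_cross_inv[u'] [v] [x] [y] [su' e ->].
have [-> ->] := cat_inj_size (etrans su (esym su')) e.
by exists v, x, y.
Qed.

Lemma step_crossS_inv_cat b i u z st st' : size u = i ->
  step (Cross b i.+1) (u ++ z :: st) st' ->
  exists v x y, st = [:: x, y & v] /\ st' = u ++ z :: cross_colors b x y ++ v.
Proof.
rewrite -cat_rcons => su /step_cross_inv_cat[]; first by rewrite size_rcons su.
by move=> v [x] [y] [-> ->]; exists v, x, y; rewrite cat_rcons.
Qed.

Lemma step_cup i u v x : size u = i ->
  step (Cup i) (u ++ v) (u ++ [:: x, x & v]).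
Proof. by move=> su; apply: (@step_cat u v [::] [:: x; x]) => //; exists x. Qed.

Lemma step_cap i u v x : size u = i ->
  step (Cap i) (u ++ [:: x, x & v]) (u ++ v).
Proof.
by move=> su; apply: (@step_cat u v [:: x; x] [::]) => //; exists x.
Qed.

Lemma step_cupS i u v x z : size u = i ->
  step (Cup i.+1) (u ++ z :: v) (u ++ [:: z, x, x & v]).
Proof. by move=> su; rewrite -!(cat_rcons z); apply: step_cup; rewrite size_rcons su. Qed.

Lemma step_capS i u v x z : size u = i ->
  step (Cap i.+1) (u ++ [:: z, x, x & v]) (u ++ z :: v).
Proof. by move=> su; rewrite -!(cat_rcons z); apply: step_cap; rewrite size_rcons su. Qed.

Lemma step_cup_inv i st st' : step (Cup i) st st' ->
  exists u v x, [/\ size u = i, st = u ++ v & st' = u ++ [:: x, x & v]].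
Proof. by case=> u [v] [p] [q] [su [x [-> ->]] -> ->]; exists u, v, x. Qed.

Lemma step_cap_inv i st st' : step (Cap i) st st' ->
  exists u v x, [/\ size u = i, st = u ++ [:: x, x & v] & st' = u ++ v].
Proof. by case=> u [v] [p] [q] [su [x [-> ->]] -> ->]; exists u, v, x. Qed.

Lemma step_cap_inv_cat i u st st' : size u = i ->
  step (Cap i) (u ++ st) st' ->
  exists v x, st = [:: x, x & v] /\ st' = u ++ v.
Proof.
move=> su /step_cap_inv[u'] [v] [x] [su' e ->].
by have [-> ->] := cat_inj_size (etrans su (esym su')) e; exists v, x.
Qed.

Lemma step_capS_inv_cat i u z st st' : size u = i ->
  step (Cap i.+1) (u ++ z :: st) st' ->
  exists v x, st = [:: x, x & v] /\ st' = u ++ z :: v.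
Proof.
rewrite -cat_rcons => su /step_cap_inv_cat[]; first by rewrite size_rcons su.
by move=> v [x] [-> ->]; exists v, x; rewrite cat_rcons.
Qed.

Lemma step_cupS_inv i st st' : step (Cup i.+1) st st' ->
  exists u v x z, [/\ size u = i, st = u ++ z :: v
    & st' = u ++ [:: z, x, x & v]].
Proof.
case/step_cup_inv=> u [v] [x] [+ -> ->].
case/lastP: u => // u z; rewrite size_rcons !cat_rcons => -[su].
by exists u, v, x, z.
Qed.

Lemma step_crossS_inv b i st st' : step (Cross b i.+1) st st' ->
  exists u v x y z, [/\ size u = i, st = u ++ [:: z, x, y & v]
    & st' = u ++ z :: cross_colors b x y ++ v].
Proof.
case/step_cross_inv=> u [v] [x] [y] [+ -> ->].
case/lastP: u => // u z; rewrite size_rcons !cat_rcons => -[su].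
by exists u, v, x, y, z.
Qed.

Lemma split_nth i (st : seq int) : (i < size st)%N ->
  exists u z v, size u = i /\ st = u ++ z :: v.
Proof.
move=> lt; exists (take i st), (nth 0 st i), (drop i.+1 st).
by rewrite -drop_nth // cat_take_drop size_takel // ltnW.
Qed.

(** Creating a zigzag needs an existing strand at place [i], which [fits] provides; the new cup
    takes its color. *)
Lemma zigzagL_simulates_rev i : simulates [::] [:: Cup i.+1; Cap i].
Proof.
move=> st [|//] /=; rewrite addn0 => /andP[/split_nth[u [z [v [su ->]]]] _] _.
exists [:: u ++ [:: z, z, z & v]; u ++ z :: v] => //=; split.
  exact: step_cupS.
by split=> //; apply: step_cap.
Qed.

Lemma zigzagR_simulates_rev i : simulates [::] [:: Cup i; Cap i.+1].
Proof.
move=> st [|//] /=; rewrite /width_above /= => /and3P[_ lt _] _.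
have /split_nth[u [z [v [su ->]]]] : (i < size st)%N by lia.
exists [:: u ++ [:: z, z, z & v]; u ++ z :: v] => //=; split.
  exact: step_cup.
by split=> //; apply: step_capS.
Qed.

Lemma slideCup_simulates b i :
  simulates [:: Cup i; Cross b i.+1] [:: Cup i.+1; Cross (~~ b) i].
Proof.
move=> st [|st1 [|st2 [|? ?]]] // _; try by move=> /=; tauto.
case=> /step_cup_inv[u] [v] [x] [su -> ->] [s2 _].
have [v1 [x1 [y1 [[<- ->] ->]]]] := step_crossS_inv_cat su s2.
(* After the slide the right leg of the cup reaches the top uncrossed, so its color must be the
   rightmost of the three outgoing ones. *)
pose z := if b then x else 2 * y1 - x.
exists [:: u ++ [:: y1, z, z & v1]; u ++ x :: cross_colors b x y1 ++ v1] => //=.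
split; first exact: step_cupS.
split=> //; have := step_cross (~~ b) [:: z & v1] y1 z su.
congr step; congr (u ++ _).
by rewrite {}/z; case: (b) => //=; congr [:: _, _, _ & _]; lia.
Qed.

Lemma slideCup_simulates_rev b i :
  simulates [:: Cup i.+1; Cross (~~ b) i] [:: Cup i; Cross b i.+1].
Proof.
move=> st [|st1 [|st2 [|? ?]]] // _; try by move=> /=; tauto.
case=> /step_cupS_inv[u] [v] [x] [z] [su -> ->] [s2 _].
have [v1 [x1 [y1 [[<- <- <-] ->]]]] := step_cross_inv_cat su s2.
(* Symmetrically, the left leg is now the uncrossed one, so [t] is the leftmost outgoing color. *)
pose t := if b then x else 2 * z - x.
exists [:: u ++ [:: t, t, z & v]; u ++ cross_colors (~~ b) z x ++ x :: v] => //=.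
split; first exact: step_cup.
split=> //; have := step_crossS b v t z t su.
congr step; congr (u ++ _).
by rewrite {}/t; case: (b) => //=; congr [:: _, _, _ & _]; lia.
Qed.

Lemma slideCap_simulates b i :
  simulates [:: Cross b i.+1; Cap i] [:: Cross (~~ b) i; Cap i.+1].
Proof.
move=> st [|st1 [|st2 [|? ?]]] // _; try by move=> /=; tauto.
case=> /step_crossS_inv[u] [v] [x] [y] [z] [su -> ->] [s2 _].
have [v1 [x1 [e ->]]] := step_cap_inv_cat su s2.
exists [:: u ++ cross_colors (~~ b) z x ++ y :: v; u ++ v1] => //=.
split; first exact: step_cross.
split=> //; case: (b) e => /= -[ez e <-].
  have := step_capS v y x su; congr step; congr (u ++ _).
  by congr [:: _, _, _ & _]; lia.
have := step_capS v y (2 * z - x) su; congr step; congr (u ++ _).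
  by congr [:: _, _, _ & _]; lia.
by congr [:: _ & _]; lia.
Qed.

Lemma slideCap_simulates_rev b i :
  simulates [:: Cross (~~ b) i; Cap i.+1] [:: Cross b i.+1; Cap i].
Proof.
move=> st [|st1 [|st2 [|? ?]]] // fits_st; try by move=> /=; tauto.
case=> /step_cross_inv[u] [v] [x] [y] [su -> ->] [s2 _].
(* [cross_colors] always has two entries, so [head] and [last] are its left and right colors and the
   default 0 is never returned. *)
have [v1 [y1 [e ->]]] : exists v1 y1,
  [:: last 0 (cross_colors (~~ b) x y) & v] = [:: y1, y1 & v1] /\
  st2 = u ++ head 0 (cross_colors (~~ b) x y) :: v1.
  by case: (b) s2 => s2; have := step_capS_inv_cat su s2.
case: v s2 e => [|w v] s2 //= [e1 e2 <-].
exists [:: u ++ x :: cross_colors b y w ++ v;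
           u ++ head 0 (cross_colors (~~ b) x y) :: v] => //=.
split; first exact: step_crossS.
split=> //; have := step_cap (head 0 (cross_colors (~~ b) x y) :: v) x su.
congr step; congr (u ++ _); case: (b) e1 e2 => /= e1 e2.
all: by congr [:: _, _, _ & _]; lia.
Qed.

Lemma R1Cup_simulates b i : simulates [:: Cup i; Cross b i] [:: Cup i].
Proof.
move=> st [|st1 [|st2 [|? ?]]] // _; try by move=> /=; tauto.
case=> s1 [s2 _]; exists [:: st1] => //=.
case/step_cup_inv: s1 s2 => u [v] [x] [su _ ->] s2.
have [v1 [x1 [y1 [[<- <- <-] ->]]]] := step_cross_inv_cat su s2.
by congr (u ++ _); case: (b) => /=; congr [:: _, _ & _]; lia.
Qed.

Lemma R1Cup_simulates_rev b i : simulates [:: Cup i] [:: Cup i; Cross b i].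
Proof.
move=> st [|st1 [|? ?]] // _; try by move=> /=; tauto.
case=> s1 _; exists [:: st1; st1] => //=; split=> //; split=> //.
case/step_cup_inv: s1 => u [v] [x] [su _ ->].
have := step_cross b v x x su; congr step; congr (u ++ _).
by case: (b) => /=; congr [:: _, _ & _]; lia.
Qed.

(** The cap equates the two colors leaving the crossing; [2 * x - y = x], or [y = 2 * y - x], gives
    [x = y]. *)
Lemma R1Cap_simulates b i : simulates [:: Cross b i; Cap i] [:: Cap i].
Proof.
move=> st [|st1 [|st2 [|? ?]]] // _; try by move=> /=; tauto.
case=> /step_cross_inv[u] [v] [x] [y] [su -> ->] [s2 _].
exists [:: st2] => //=; split=> //.
have [v1 [z [e ->]]] := step_cap_inv_cat su s2.
have [-> [-> ->]] : x = z /\ y = z /\ v = v1.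
  by case: (b) e => /= -[e1 e2 <-]; do !split; lia.
exact: step_cap.
Qed.

Lemma R1Cap_simulates_rev b i : simulates [:: Cap i] [:: Cross b i; Cap i].
Proof.
move=> st [|st1 [|? ?]] // _; try by move=> /=; tauto.
case=> s1 _; exists [:: st; st1] => //=; split=> //.
case/step_cap_inv: s1 => u [v] [x] [su -> _].
have := step_cross b v x x su; congr step; congr (u ++ _).
by case: (b) => /=; congr [:: _, _ & _]; lia.
Qed.

(** Reflection in the color of the over-strand is an involution, so the opposite crossing restores
    the state. *)
Lemma cross_colorsK b u v x y i : size u = i ->
  step (Cross (~~ b) i) (u ++ cross_colors b x y ++ v) (u ++ [:: x, y & v]).
Proof.
move=> su; case: b.
  have := step_cross false v (2 * x - y) x su; congr step; congr (u ++ _).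
  by rewrite /=; congr [:: _, _ & _]; lia.
have := step_cross true v y (2 * y - x) su; congr step; congr (u ++ _).
by rewrite /=; congr [:: _, _ & _]; lia.
Qed.

Lemma step_cross_fun b i st st1 st2 :
  step (Cross b i) st st1 -> step (Cross b i) st st2 -> st1 = st2.
Proof.
case/step_cross_inv=> u [v] [x] [y] [su -> ->] s2.
by have [v1 [x1 [y1 [[<- <- <-] ->]]]] := step_cross_inv_cat su s2.
Qed.

Lemma R2_simulates b i : simulates [:: Cross b i; Cross (~~ b) i] [::].
Proof.
move=> st [|st1 [|st2 [|? ?]]] // _; try by move=> /=; tauto.
case=> /step_cross_inv[u] [v] [x] [y] [su -> ->] [s2 _]; exists [::] => //=.
exact: step_cross_fun (cross_colorsK _ _ _ _ su) s2.
Qed.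

Lemma R2_simulates_rev b i : simulates [::] [:: Cross b i; Cross (~~ b) i].
Proof.
move=> st [|//] /= /and3P[lt _ _] _.
have /split_nth[u [x [v [su est]]]] : (i < size st)%N by lia.
case: v est => [|y v] est; first by move: lt; rewrite est size_cat /=; lia.
rewrite {}est; exists [:: u ++ cross_colors b x y ++ v; u ++ [:: x, y & v]] => //=.
split; first exact: step_cross.
by split=> //; apply: cross_colorsK.
Qed.

Definition cross_left (b : bool) (x y : int) : int :=
  if b then 2 * x - y else y.

Definition cross_right (b : bool) (x y : int) : int :=
  if b then x else 2 * y - x.

Lemma cross_colorsE b x y :
  cross_colors b x y = [:: cross_left b x y; cross_right b x y].
Proof. by case: b. Qed.

(** The unprimed colors occur on one side of the move, the primed ones on the other. In each of the
    six acyclic patterns the identities are linear; they fail in the two cyclic ones. *)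
Lemma R3_colors bxy bxz byz x y z : (bxy == byz) ==> (bxz == bxy) ->
  let a := cross_left bxy x y in let b := cross_right bxy x y in
  let c := cross_left bxz b z in let d := cross_right bxz b z in
  let b' := cross_left byz y z in let c' := cross_right byz y z in
  let a' := cross_left bxz x b' in let d' := cross_right bxz x b' in
  [/\ cross_left byz a c = a', cross_right byz a c = cross_left bxy d' c'
    & d = cross_right bxy d' c'].
Proof. by case: bxy; case: bxz; case: byz => //= _; split; lia. Qed.

Lemma R3_simulates bxy bxz byz i : (bxy == byz) ==> (bxz == bxy) ->
  simulates [:: Cross bxy i; Cross bxz i.+1; Cross byz i]
            [:: Cross byz i.+1; Cross bxz i; Cross bxy i.+1].
Proof.
move=> ac st [|st1 [|st2 [|st3 [|? ?]]]] // _; try by move=> /=; tauto.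
case=> /step_cross_inv[u] [v] [x] [y] [su -> ->]; rewrite cross_colorsE.
case=> s2; have [v1 [x1 [z [[<- ->] ->]]]] := step_crossS_inv_cat su s2.
rewrite cross_colorsE => -[s3 _].
have [v2 [x2 [y2 [[<- <- <-] ->]]]] := step_cross_inv_cat su s3.
have [e1 e2 e3] := R3_colors x y z ac.
rewrite cross_colorsE e1 e2 e3.
(* The last states must agree, which fixes the third one; the first two are determined by the steps
   that follow. *)
eexists [:: _; _; _]; last by rewrite /=; reflexivity.
split; first exact: step_crossS.
rewrite cross_colorsE; split; first exact: step_cross.
rewrite [cross_colors bxz _ _]cross_colorsE; split=> //.
set b' := cross_left byz y z; set c' := cross_right byz y z.
have := step_crossS bxy v1 (cross_right bxz x b') c' (cross_left bxz x b') su.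
by rewrite cross_colorsE.
Qed.

Lemma R3_simulates_rev bxy bxz byz i : (bxy == byz) ==> (bxz == bxy) ->
  simulates [:: Cross byz i.+1; Cross bxz i; Cross bxy i.+1]
            [:: Cross bxy i; Cross bxz i.+1; Cross byz i].
Proof.
move=> ac st [|st1 [|st2 [|st3 [|? ?]]]] // _; try by move=> /=; tauto.
case=> /step_crossS_inv[u] [v] [y] [z] [x] [su -> ->]; rewrite cross_colorsE.
case=> s2; have [v1 [x1 [y1 [[<- <- <-] ->]]]] := step_cross_inv_cat su s2.
rewrite cross_colorsE => -[s3 _].
have [v2 [x2 [y2 [[<- <- <-] ->]]]] := step_crossS_inv_cat su s3.
have [e1 e2 e3] := R3_colors x y z ac.
rewrite cross_colorsE -e1 -e2 -e3.
eexists [:: _; _; _]; last by rewrite /=; reflexivity.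
split; first exact: step_cross.
rewrite cross_colorsE; split; first exact: step_crossS.
rewrite [cross_colors bxz _ _]cross_colorsE; split=> //.
set a := cross_left bxy x y; set b' := cross_right bxy x y.
have := step_cross byz (cross_right bxz b' z :: v) a (cross_left bxz b' z) su.
by rewrite cross_colorsE.
Qed.

Lemma local_move_simulates a b : local_move a b ->
  simulates a b /\ simulates b a.
Proof.
case=> {a b}.
- by move=> s t le; split; [apply: exchange_simulates|apply: exchange_simulates_rev].
- by move=> i; split; [apply: zigzagL_simulates|apply: zigzagL_simulates_rev].
- by move=> i; split; [apply: zigzagR_simulates|apply: zigzagR_simulates_rev].
- by move=> b i; split; [apply: slideCup_simulates|apply: slideCup_simulates_rev].
- by move=> b i; split; [apply: slideCap_simulates|apply: slideCap_simulates_rev].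
- by move=> b i; split; [apply: R1Cup_simulates|apply: R1Cup_simulates_rev].
- by move=> b i; split; [apply: R1Cap_simulates|apply: R1Cap_simulates_rev].
- by move=> b i; split; [apply: R2_simulates|apply: R2_simulates_rev].
by move=> bxy bxz byz i ac; split; [apply: R3_simulates|apply: R3_simulates_rev].
Qed.

(** * Isotopy invariance of non-constant runs *)

Lemma step_size s st st' : step s st st' -> size st' = width_above (size st) s.
Proof.
case=> u [v] [p] [q] [su l -> ->]; rewrite /width_above !size_cat.
by have [-> ->] := local_coloring_size l; lia.
Qed.

Lemma run_size st w ss : run st w ss ->
  size (last st ss) = foldl width_above (size st) w.
Proof.
elim: w st ss => [|s w IH] st [|st' ss] //= [/step_size e /IH ->].
by rewrite e.
Qed.

Lemma closes_fits n u b v : closes n (u ++ b ++ v) ->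
  fits (foldl width_above n u) b.
Proof.
elim: u n => [|s u IH] n /=; last by case/andP=> _ /IH.
by elim: b n => //= s b IH n /andP[-> /IH].
Qed.

Lemma constant_last k st ss : all (pred1 k) st -> constant_states k ss ->
  all (pred1 k) (last st ss).
Proof. by elim: ss st => //= st' ss IH st _ /andP[/IH H /H]. Qed.

(** The segment over [a] is replaced by one over [b] with the same end states. If the new run were
    constant, these end states would be constant too, and rigidity of [a] would make the old run
    constant. *)
Lemma nonconstant_run_transfer u v a b : simulates a b -> rigid a ->
  closes 0 (u ++ b ++ v) ->
  has_nonconstant_run (u ++ a ++ v) -> has_nonconstant_run (u ++ b ++ v).
Proof.
move=> sim rig cl [ss0 /run_cat[ss1 [ss' [-> r1]]]].
move=> /run_cat[ss [ss2 [-> r r2]]] nc.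
have [|ssb rb eb] := sim _ _ _ r.
  by rewrite (run_size r1); apply: closes_fits cl.
exists (ss1 ++ ssb ++ ss2).
  apply/run_cat; exists ss1, (ssb ++ ss2); split=> //.
  by apply/run_cat; exists ssb, ss2; rewrite eb.
move=> k; apply: contra (nc k); rewrite /constant_states !all_cat.
case/and3P=> k1 kb ->; rewrite k1 andbT /=.
apply: rig r _ _; first exact: constant_last.
by rewrite -eb; apply: constant_last => //; apply: constant_last.
Qed.

Lemma diagram_move_nonconstant_run (D E : diagram) : diagram_move D E ->
  has_nonconstant_run (val D) <-> has_nonconstant_run (val E).
Proof.
case=> u [v] [a] [b] [m eD eE].
have [[sab sba] [ra rb]] := (local_move_simulates m, local_move_rigid m).
have /andP[_ cD] := valP D; have /andP[_ cE] := valP E.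
rewrite eD in cD *; rewrite eE in cE *.
by split; apply: nonconstant_run_transfer.
Qed.

Lemma isotopic_nonconstant_run (D E : diagram) : isotopic D E ->
  has_nonconstant_run (val D) <-> has_nonconstant_run (val E).
Proof.
move/boolp.asboolP; elim=> {D E}.
- exact: diagram_move_nonconstant_run.
- by [].
- by move=> D E _ IH; split=> /IH.
by move=> D E F _ IH1 _ IH2; split=> [/IH1/IH2|/IH2/IH1].
Qed.

(** * Colorings of arcs and runs *)

Definition boundary_color (st st' : seq int) (e : boundary) : int :=
  nth 0 (if e.1 then st' else st) e.2.

Lemma step_joins s st st' e e' : step s st st' -> slice_joins s e e' ->
  boundary_color st st' e = boundary_color st st' e'.
Proof.
case=> u [v] [p] [q] [su l -> ->]; have [sp sq] := local_coloring_size l.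
case: e e' => [t n] [t' n']; rewrite /boundary_color /slice_joins /= -sp -sq -su.
case/or3P=> [/and4P[/negbTE-> -> lt /eqP->]|/and4P[/negbTE-> -> le /eqP e]|].
- by rewrite !nth_cat lt.
- rewrite !catA !nth_cat !size_cat ltnNge le /= ifF; first by congr nth; lia.
  by lia.
case: s l su {sp sq} => [i|i|b i] /= => [[x [-> ->]]|[x [-> ->]]|[x [y [-> ->]]]] su.
- by case/andP=> /eqP[-> ->] /eqP[-> ->]; rewrite !nth_cat -su ltnn subnn ifF /= ?subSnn //; lia.
- by case/andP=> /eqP[-> ->] /eqP[-> ->]; rewrite !nth_cat -su ltnn subnn ifF /= ?subSnn //; lia.
rewrite /over_in /over_out; case: b => /= /andP[/eqP[-> ->] /eqP[-> ->]];
 by rewrite !nth_cat -su addn0 addn1 ltnn subnn ifF /= ?subSnn //; lia.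
Qed.

Lemma step_crossing b i st st' : step (Cross b i) st st' ->
  2 * boundary_color st st' (over_in b i) =
  boundary_color st st' (under_in b i) + boundary_color st st' (under_out b i).
Proof.
case/step_cross_inv=> u [v] [x] [y] [<- -> ->].
have nth0 w : nth 0 (u ++ w) (size u) = nth 0 w 0 by rewrite nth_cat ltnn subnn.
have nth1 w : nth 0 (u ++ w) (size u).+1 = nth 0 w 1.
  by rewrite nth_cat ltnNge leqnSn /= subSnn.
rewrite /boundary_color /over_in /under_in /under_out.
by case: b; rewrite /= ?addn0 ?addn1 !nth0 ?nth1 /=; lia.
Qed.

Lemma take2_drop (st : seq int) i : (i.+2 <= size st)%N ->
  take 2 (drop i st) = [:: nth 0 st i; nth 0 st i.+1].
Proof.
move=> le; rewrite (drop_nth 0); last exact: ltnW.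
by rewrite (drop_nth 0) //= take0.
Qed.

(** Converse of [step_joins] and [step_crossing]. The relation on joined ends is only assumed for
    places inside the states, since only these correspond to points of a diagram. *)
Lemma step_of_joins s st st' :
  (leftmost s + arity_in s <= size st)%N ->
  size st' = width_above (size st) s ->
  (forall e e' : boundary,
     (e.2 < size (if e.1 then st' else st))%N ->
     (e'.2 < size (if e'.1 then st' else st))%N ->
     slice_joins s e e' -> boundary_color st st' e = boundary_color st st' e') ->
  (if s is Cross b i then
     2 * boundary_color st st' (over_in b i) =
     boundary_color st st' (under_in b i) + boundary_color st st' (under_out b i)
   else True) ->
  step s st st'.
Proof.
have [i ei] : exists i, i = leftmost s by exists (leftmost s).
rewrite /width_above -ei => le sz joins crossing.
have [le1 le2] : (i <= size st)%N /\ (i <= size st')%N by split; lia.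
exists (take i st), (drop (i + arity_in s) st),
  (take (arity_in s) (drop i st)), (take (arity_out s) (drop i st')).
split.
- by rewrite ei size_takel -?ei.
- case: s ei le sz joins crossing => [j|j|b j] /= ej le sz joins crossing; subst j.
  + rewrite take0 take2_drop; last by lia.
    have := joins (true, i) (true, i.+1); rewrite /boundary_color /= => <-.
    * by exists (nth 0 st' i).
    * by lia.
    * by lia.
    * by rewrite /slice_joins /= !eqxx.
  + rewrite take0 take2_drop; last by lia.
    have := joins (false, i) (false, i.+1); rewrite /boundary_color /= => <-.
    * by exists (nth 0 st i).
    * by lia.
    * by lia.
    * by rewrite /slice_joins /= !eqxx.
  + rewrite !take2_drop; [|lia|lia].
    exists (nth 0 st i), (nth 0 st i.+1); split=> //.
    have := joins (over_in b i) (over_out b i).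
    rewrite /slice_joins !eqxx !orbT; move: crossing.
    rewrite /boundary_color /over_in /over_out /under_in /under_out.
    by case: b joins => _ /=; rewrite ?addn0 ?addn1 => e1 e2;
      rewrite -e2; try lia; congr [:: _; _]; lia.
- by rewrite addnC -drop_drop !cat_take_drop.
(* The first two disjuncts of [slice_joins] identify the vertical strands on the left, and then
   those on the right, the latter shifted by the change of width. *)
have -> : take i st = take i st'.
  apply: (@eq_from_nth int 0); first by rewrite !size_takel.
  move=> j; rewrite size_takel // => lt; rewrite !nth_take //.
  apply: (joins (false, j) (true, j)) => /=; try lia.
  by rewrite /slice_joins /= -ei lt eqxx.
have -> : drop (i + arity_in s) st = drop (i + arity_out s) st'.
  apply: (@eq_from_nth int 0); first by rewrite !size_drop; lia.
  move=> j; rewrite size_drop => lt; rewrite !nth_drop.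
  apply: (joins (false, _) (true, _)) => /=; try lia.
  apply/or3P/Or32; apply/and4P; split=> //=; first by rewrite -ei; lia.
  by apply/eqP; lia.
by rewrite [(i + _)%N]addnC -drop_drop !cat_take_drop.
Qed.

(** The list starts at [m.+1] because a run omits its initial state. *)
Lemma run_map (f : nat -> seq int) m w :
  (forall k, (k < size w)%N -> step (nth (Cup 0) w k) (f (m + k)%N) (f (m + k).+1)) ->
  run (f m) w [seq f k | k <- iota m.+1 (size w)].
Proof.
elim: w m => //= s w IH m H; split; first by have := H 0%N isT; rewrite addn0.
by apply: IH => k lt; have := H k.+1 lt; rewrite addnS.
Qed.

Lemma run_nth st w ss k : run st w ss -> (k < size w)%N ->
  step (nth (Cup 0) w k) (nth [::] (st :: ss) k) (nth [::] (st :: ss) k.+1).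
Proof.
by elim: w st ss k => [|s w IH] st [|st' ss] [|k] //= [H /IH]; try apply.
Qed.

Lemma size_run st w ss : run st w ss -> size ss = size w.
Proof. by elim: w st ss => [|s w IH] st [|st' ss] //= [_ /IH->]. Qed.

Lemma width_take_succ w k : (k < size w)%N ->
  width (take k.+1 w) = width_above (width (take k w)) (nth (Cup 0) w k).
Proof. by move=> lt; rewrite (take_nth (Cup 0)) // /width foldl_rcons. Qed.

Lemma closes_nth n w k : closes n w -> (k < size w)%N ->
  (leftmost (nth (Cup 0%N) w k) + arity_in (nth (Cup 0%N) w k)
    <= foldl width_above n (take k w))%N.
Proof.
elim: w n k => [|s w IH] n [|k] //= /andP[le cl] //.
exact: IH.
Qed.

Section Points.
Variable D : diagram.
Local Notation w := (val D).

Lemma line_le (x : point D) : (line x <= size w)%N.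
Proof. exact: (leq_ord (tag x)). Qed.

Lemma place_lt (x : point D) : (place x < width (take (line x) w))%N.
Proof. exact: (ltn_ord (tagged x)). Qed.

Lemma point_exists k j : (k <= size w)%N -> (j < width (take k w))%N ->
  exists x : point D, line x = k /\ place x = j.
Proof.
move=> lek ltj; have ltk : (k < (size w).+1)%N by [].
by exists (existT _ (Ordinal ltk) (Ordinal (ltj : (j < width (take (Ordinal ltk) w))%N))).
Qed.

Lemma point_inj (x y : point D) : line x = line y -> place x = place y -> x = y.
Proof.
case: x y => [k j] [k' j'] /val_inj /= ek; rewrite /line /= in ek; subst k'.
by move=> /val_inj /= ->.
Qed.

Lemma arc_through_adjacent (x y : point D) : adjacent x y ->
  arc_through x = arc_through y.
Proof.
move=> adj; apply: val_inj; apply/fingraph.rootP; first exact: same_strand_connect_sym.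
by apply: connect1; rewrite /same_strand adj.
Qed.

Lemma arc_through_val (a : diagram_arc D) : arc_through (val a) = a.
Proof. by apply: val_inj; apply/eqP; apply: (valP a). Qed.

Definition integer_coloring (c : diagram_arc D -> int) : Prop :=
  forall t : crossing D,
    2 * c (over_arc t) = c (under_arc1 t) + c (under_arc2 t).

Lemma diagram_step_bounds (k : nat) : (k < size w)%N ->
  (leftmost (slice_at D k) + arity_in (slice_at D k) <= width (take k w))%N.
Proof. by move=> lt; apply: closes_nth => //; have /andP[] := valP D. Qed.

Section ArcColoring.
Variable c : diagram_arc D -> int.
Hypothesis cP : integer_coloring c.

(** Indexing by plain numbers avoids the dependent type of points; the value 0 occurs only where
    there is no point. *)
Let height_color (k j : nat) : int :=
  if [pick x : point D | (line x == k) && (place x == j)] is Some x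
  then c (arc_through x) else 0.

Let height_state (k : nat) : seq int := mkseq (height_color k) (width (take k w)).

Lemma height_colorE x : height_color (line x) (place x) = c (arc_through x).
Proof.
rewrite /height_color; case: pickP => [y /andP[/eqP el /eqP ep]|/(_ x)].
  by rewrite (point_inj el ep).
by rewrite !eqxx.
Qed.

Lemma nth_height_state x : nth 0 (height_state (line x)) (place x) = c (arc_through x).
Proof. by rewrite nth_mkseq ?place_lt // height_colorE. Qed.

Lemma boundary_pointP k (e : boundary) : (k < size w)%N ->
  (e.2 < size (if e.1 then height_state k.+1 else height_state k))%N ->
  exists x : point D, [/\ lies_at k x e, (line x == k.+1, place x) = e
    & boundary_color (height_state k) (height_state k.+1) e = c (arc_through x)].
Proof.
case: e => [t j] ltk; rewrite (fun_if size) !size_mkseq /= => ltj.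
have [x [lx px]] : exists x : point D, line x = (k + t)%N /\ place x = j.
  by case: t ltj => /= ltj; rewrite ?addn0 ?addn1; apply: point_exists => //; apply: ltnW.
exists x; rewrite /lies_at lx px !eqxx; split=> //.
  by congr pair; case: (t) => /=; lia.
rewrite -nth_height_state lx px /boundary_color /=.
by case: (t); rewrite ?addn0 ?addn1.
Qed.

Lemma height_step k : (k < size w)%N ->
  step (slice_at D k) (height_state k) (height_state k.+1).
Proof.
move=> ltk; have bnd := diagram_step_bounds ltk; apply: step_of_joins.
- by rewrite size_mkseq.
- by rewrite !size_mkseq width_take_succ.
- move=> e e' lte lte'.
  have [x [/andP[/eqP lx _] ex ->]] := boundary_pointP ltk lte.
  have [y [/andP[/eqP ly _] ey ->]] := boundary_pointP ltk lte'.
  move=> joins; congr c; apply: arc_through_adjacent.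
  apply/existsP; exists (Ordinal ltk); apply/and3P; split=> /=.
  + by rewrite lx; case: (e.1) => /=; lia.
  + by rewrite ly; case: (e'.1) => /=; lia.
  by rewrite ex ey.
case es: (slice_at D k) bnd => [//|//|b i] /= bnd.
have szk : size (height_state k) = width (take k w) by rewrite size_mkseq.
have szk1 : size (height_state k.+1) = width (take k w).
  by rewrite size_mkseq width_take_succ // -/(slice_at D k) es /width_above /=; lia.
have [|x [lx _ ->]] := @boundary_pointP k (over_in b i) ltk.
  by rewrite /= szk; case: (b) => /=; lia.
have [|y [ly _ ->]] := @boundary_pointP k (under_in b i) ltk.
  by rewrite /= szk; case: (b) => /=; lia.
have [|z [lz _ ->]] := @boundary_pointP k (under_out b i) ltk.
  by rewrite /= szk1; case: (b) => /=; lia.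
have cr : is_crossing (x, y, z).
  by apply/existsP; exists (Ordinal ltk); rewrite /= es lx ly lz.
exact: cP (Sub (x, y, z) cr).
Qed.

Lemma arc_coloring_run a b : c a <> c b -> has_nonconstant_run w.
Proof.
move=> cab; have r0 := @run_map height_state 0 w height_step.
exists [seq height_state k | k <- iota 1 (size w)].
  by move: r0; rewrite {1}/height_state take0.
move=> k; apply/negP => /allP const_k; apply: cab.
suff ck d : c d = k by rewrite !ck.
rewrite -[d]arc_through_val -nth_height_state; set x := val d.
(* The bottom line has width 0 and carries no point, so the line of [x] is among those listed in the
   run. *)
have lx : (0 < line x)%N.
  by rewrite lt0n; apply/eqP => l0; have := place_lt x; rewrite l0 take0.
have := const_k (height_state (line x)); rewrite map_f; last first.
  by rewrite mem_iota lx add1n ltnS line_le.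
by move=> /(_ isT) /allP /(_ _ (mem_nth _ _)) H; apply/eqP/H; rewrite size_mkseq place_lt.
Qed.

End ArcColoring.

(** The color that the run gives to a point is preserved by [adjacent], hence constant on each arc,
    and may be read at the representative of the arc. *)
Lemma run_arc_coloring : has_nonconstant_run w ->
  exists2 c : diagram_arc D -> int, integer_coloring c
    & exists a b, c a <> c b.
Proof.
case=> ss r nc; pose st k := nth [::] ([::] :: ss) k.
have szss := size_run r.
have st_step k : (k < size w)%N -> step (slice_at D k) (st k) (st k.+1).
  exact: run_nth r.
have st_size k : (k <= size w)%N -> size (st k) = width (take k w).
  elim: k => [|k IH] lek; first by rewrite take0.
  by rewrite width_take_succ // (step_size (st_step _ lek)) IH // ltnW.
pose pc (x : point D) := nth 0 (st (line x)) (place x).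
have pc_boundary k (x : point D) e : lies_at k x e ->
    boundary_color (st k) (st k.+1) e = pc x.
  case: e => [t j] /andP[/eqP lx /eqP px]; rewrite /pc lx px /boundary_color /=.
  by case: (t); rewrite ?addn0 ?addn1.
have pc_adjacent x y : adjacent x y -> pc x = pc y.
  case/existsP=> k /and3P[kx ky joins].
  have := step_joins (st_step k (ltn_ord k)) joins.
  have at_line (z : point D) : (k <= line z <= k.+1)%N -> lies_at k z (line z == k.+1, place z).
    by rewrite /lies_at /= eqxx andbT => /andP[]; case: eqP => /=; lia.
  by rewrite (pc_boundary _ _ _ (at_line _ kx)) (pc_boundary _ _ _ (at_line _ ky)).
have pc_connect x y : connect (@same_strand D) x y -> pc x = pc y.
  case/connectP=> p + ->; elim: p x => //= z p IH x /andP[/orP xz /IH <-].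
  by case: xz => /pc_adjacent.
have pc_arc x : pc (val (arc_through x)) = pc x.
  by apply/esym/pc_connect/connect_root.
exists (fun a => pc (val a)).
  move=> t; rewrite /over_arc /under_arc1 /under_arc2 !pc_arc.
  have /existsP[k] := valP t; have := st_step k (ltn_ord k).
  case: (slice_at D k) => // b i s1 /and3P[l1 l2 l3]; have := step_crossing s1.
  by rewrite (pc_boundary _ _ _ l1) (pc_boundary _ _ _ l2) (pc_boundary _ _ _ l3).
case: (pselect (exists a b : diagram_arc D, pc (val a) <> pc (val b))) => // const.
exfalso.
(* If all arcs had the same color [k], every entry of every state would be [k]. The value 0 stands
   for a diagram without arcs. *)
pose k := if [pick a : diagram_arc D] is Some a then pc (val a) else 0.
have pck x : pc x = k.
  rewrite -pc_arc /k; case: pickP => [a _|/(_ (arc_through x)) //].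
  by apply: contrapT => ax; apply: const; exists (arc_through x), a.
have /negP[] := nc k; apply/(all_nthP [::]) => n ltn; apply/(all_nthP 0) => j ltj.
have len : (n.+1 <= size w)%N by rewrite -szss.
have [|x [lx px]] := @point_exists n.+1 j len; first by rewrite -st_size.
by apply/eqP; rewrite -(pck x) /pc lx px.
Qed.

End Points.

(** * Vanishing of the determinant *)

(** Multiplying by the adjugate gives [\det M *: v = 0], and the integers are a domain. *)
Lemma det0_of_kernel n (M : 'M[int]_n) (v : 'cV[int]_n) :
  M *m v = 0 -> v != 0 -> \det M = 0.
Proof.
move=> Mv; apply: contraNeq => dM.
have /matrixP Dv : \adj M *m M *m v = 0 by rewrite -mulmxA Mv mulmx0.
apply/eqP/matrixP=> i j; have := Dv i j.
rewrite mul_adj_mx mul_scalar_mx !mxE => /eqP.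
by rewrite mulf_eq0 (negPf dM) => /eqP.
Qed.

(** If [g] repeats a column, the minor is zero. Otherwise [g] misses exactly one column [z]; the
    vector [v - v z] is still in the kernel of [A] and vanishes at [z], so it restricts to a kernel
    vector of the minor, nonzero because [v] is not constant. *)
Lemma minor_eq0 m n (A : 'M[int]_(m, n)) (v : 'I_n -> int)
    (f : 'I_n.-1 -> 'I_m) (g : 'I_n.-1 -> 'I_n) :
  (forall i, \sum_j A i j = 0) -> (forall i, \sum_j A i j * v j = 0) ->
  (exists i j, v i <> v j) -> \det (mxsub f g A) = 0.
Proof.
move=> A1 Av [i0 [j0 vij]].
have [g_inj|] := boolP (injectiveb g); last first.
  case/injectivePn=> i [j nij gij]; rewrite -det_tr.
  by apply: (determinant_alternate nij) => k; rewrite !mxE gij.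
have n_gt0 : (0 < n)%N by apply: leq_ltn_trans (ltn_ord i0).
have [z zg] : exists z, z \notin codom g.
  apply/existsP; rewrite -negb_forall; apply/negP => /forallP all_g.
  have : (#|'I_n| <= size (codom g))%N.
    by apply: leq_trans (card_size _); apply: subset_leq_card; apply/subsetP.
  by rewrite size_codom !card_ord; lia.
have g_uniq : uniq (codom g) by rewrite map_inj_uniq ?enum_uniq //; apply/injectiveP.
have codomE : codom g =i predC1 z.
  have [||_ codomE] := @uniq_min_size _ (codom g) (enum (predC1 z)) g_uniq.
  - by move=> x xg; rewrite mem_enum inE; apply: contraNneq zg => <-.
  - by rewrite -cardE cardC1 size_codom !card_ord.
  by move=> x; rewrite codomE mem_enum.
pose u j := v j - v z.
have Au i : \sum_k A i (g k) * u (g k) = 0.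
  rewrite -(big_image _ _ g predT (fun j => A i j * u j)) big_uniq //=.
  rewrite (eq_bigl (fun j => j != z)) => [|j]; last by rewrite codomE.
  have : \sum_j A i j * u j = 0.
    under eq_bigr do rewrite mulrBr.
    by rewrite sumrB -mulr_suml Av A1 mul0r subr0.
  by rewrite (bigD1 z) //= {1}/u subrr mulr0 add0r.
apply: (@det0_of_kernel _ _ (\col_k u (g k))).
  apply/matrixP=> i j; rewrite !mxE; apply: etrans (Au (f i)).
  by apply: eq_bigr => k _; rewrite !mxE.
apply/eqP => /matrixP u0; apply: vij.
suff vE x : v x = v z by rewrite !vE.
have [-> //|xz] := eqVneq x z.
have /codomP[k ->] : x \in codom g by rewrite codomE inE.
by have := u0 k 0; rewrite !mxE /u => /eqP; rewrite subr_eq0 => /eqP.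
Qed.

Lemma diagram_det_eq0 (D : diagram) (c : diagram_arc D -> int) :
  integer_coloring c -> (exists a b, c a <> c b) -> diagram_det D = 0%N.
Proof.
move=> cP [a [b cab]].
(* Used twice: the constant [d] gives zero row sums, and [d := c] puts the coloring in the
   kernel. *)
have row_sum (i : 'I_#|{: crossing D}|) (d : diagram_arc D -> int) :
  \sum_j coloring_matrix D i j * d (enum_val j) =
  let t := enum_val i in
  2 * d (over_arc t) - d (under_arc1 t) - d (under_arc2 t).
  have delta_sum (o : diagram_arc D) : \sum_x (x == o)%:R * d x = d o.
    rewrite (bigD1 o) //= eqxx mul1r big1 ?addr0 // => x /negPf->.
    by rewrite mul0r.
  rewrite /= -!delta_sum mulr_sumr -!sumrB -[RHS]/(\sum_(x in {: diagram_arc D}) _) [RHS]big_enum_val.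
  by apply: eq_bigr => j _; rewrite mxE /=; ring.
rewrite /diagram_det big1 // => f _; rewrite big1 // => g _.
rewrite (@minor_eq0 _ _ _ (fun j => c (enum_val j))) //.
- by move=> i; have := row_sum i (fun=> 1); under eq_bigr do rewrite mulr1; move->.
- by move=> i; rewrite row_sum /= cP; lia.
by exists (enum_rank a), (enum_rank b); rewrite !enum_rankK.
Qed.

(** The determinant is computed on [repr L], so the coloring of [D] is first turned into a run,
    carried along the isotopy, and turned back into an arc coloring. *)
Lemma link_det_eq0 (L : link) (D : diagram) (c : diagram_arc D -> int) :
  diagram_of D L -> integer_coloring c -> (exists a b, c a <> c b) ->
  link_det L = 0%N.
Proof.
move=> DL cP [a [b cab]].
have DE : isotopic D (repr L) by apply/eqmodP; rewrite reprK.
have /run_arc_coloring[c' c'P nc'] : has_nonconstant_run (val (repr L)).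
  by apply/(isotopic_nonconstant_run DE)/(arc_coloring_run cP cab).
exact: diagram_det_eq0 c'P nc'.
Qed.

(** * Five-element color sets modulo 11 *)

Fixpoint bitseqs (n : nat) : seq bitseq :=
  if n is n'.+1 then [seq b :: m | b <- [:: true; false], m <- bitseqs n']
  else [:: [::]].

Lemma mem_bitseqs m : m \in bitseqs (size m).
Proof. by elim: m => // b m IH; apply: (allpairs_f cons) => //; case: b. Qed.

Definition affine_preimage_mask (r : seq nat) (l k : nat) : bitseq :=
  [seq (l * i + k) %% 11 \in r | i <- iota 0 11]%N.

Definition affine_preimage_masks (r : seq nat) : seq bitseq :=
  [seq affine_preimage_mask r l k | l <- iota 1 10, k <- iota 0 11].

(* Representatives of the affine classes of 5-subsets of Z/11, other than the two
   classes of the theorem, each with distinct integers that satisfy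
   2 y = x + z whenever the corresponding residues do so modulo 11. *)
Definition lifted_palettes : seq (seq nat * seq nat) :=
  [:: ([:: 0; 1; 2; 3; 4], [:: 0; 1; 2; 3; 4]);
      ([:: 0; 1; 2; 3; 5], [:: 0; 1; 2; 3; 5]);
      ([:: 0; 1; 2; 3; 7], [:: 0; 2; 4; 6; 3]);
      ([:: 0; 1; 2; 4; 5], [:: 0; 1; 2; 4; 3])]%N.

Definition palettes : seq (seq nat) :=
  [:: [:: 0; 1; 2; 3; 6], [:: 0; 1; 2; 4; 7] & unzip1 lifted_palettes]%N.

(** Exhaustive computation: subsets are masks of eleven bits, and each mask of weight 5 is found
    among the preimages of the six palettes under the 110 affine bijections. *)
Lemma bitseqs_affine_preimage :
  let masks := flatten (map affine_preimage_masks palettes) in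
  all (fun m => (count id m == 5%N) ==> (m \in masks)) (bitseqs 11).
Proof. by vm_compute. Qed.

(** A residue outside [rv.1] is sent to the default 0; the lift is meaningful only on the
    palette. *)
Definition lift_color (rv : seq nat * seq nat) (x : 'Z_11) : int :=
  (nth 0 rv.2 (index (val x) rv.1))%:Z.

Lemma lifted_palettesP rv : rv \in lifted_palettes ->
  (forall x y : 'Z_11, val x \in rv.1 -> val y \in rv.1 ->
     lift_color rv x = lift_color rv y -> x = y) /\
  (forall x y z : 'Z_11, val x \in rv.1 -> val y \in rv.1 -> val z \in rv.1 ->
     2%:R * y = x + z ->
     2 * lift_color rv y = lift_color rv x + lift_color rv z).
Proof.
pose lift (rv : seq nat * seq nat) (a : nat) : nat := nth 0%N rv.2 (index a rv.1).
have check : all (fun rv : seq nat * seq nat => let: r := rv.1 in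
    all (fun a => all (fun b => ((lift rv a == lift rv b) ==> (a == b))
      && all (fun c => ((b + b) %% 11 == (a + c) %% 11) ==>
                       (lift rv b + lift rv b == lift rv a + lift rv c)) r) r) r)%N
    lifted_palettes by vm_compute.
move=> /(allP check){check} /allP check; split=> [x y|x y z] xr yr.
  case=> e; have /allP/(_ _ yr)/andP[+ _] := check _ xr.
  by rewrite /lift e eqxx => /eqP /val_inj.
move=> zr e; have /allP/(_ _ yr)/andP[_ /allP/(_ _ zr)] := check _ xr.
have -> : ((val y + val y) %% 11 == (val x + val z) %% 11)%N.
  by move: e; rewrite mulr_natl mulr2n => /(congr1 val) /eqP.
by rewrite /lift /lift_color mulr_natl mulr2n -!PoszD => /eqP->.
Qed.

Section Affine.
Variables (l k : nat).
Hypothesis l_mem : l \in iota 1 10.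

Let unit_l : (l%:R : 'Z_11) \is a GRing.unit.
Proof.
rewrite unitZpE //.
have : all (coprime 11) (iota 1 10) by vm_compute.
by move/allP; apply.
Qed.

Lemma affine_inj : injective (fun x : 'Z_11 => l%:R * x + k%:R).
Proof. by move=> x y /addIr /(mulrI unit_l). Qed.

Definition affine_perm : {perm 'Z_11} := perm affine_inj.

Lemma affine_permE x : affine_perm x = l%:R * x + k%:R.
Proof. exact: permE. Qed.

Lemma val_affine_perm x : val (affine_perm x) = ((l * val x + k) %% 11)%N.
Proof.
rewrite affine_permE -[in LHS](natr_Zp x) -natrM -natrD.
exact: val_Zp_nat.
Qed.

Lemma affine_perm_automorphism : coloring_automorphism affine_perm.
Proof. by move=> a b; rewrite /quandle_op !affine_permE; ring. Qed.

End Affine.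

(** The mask of [S] is one of those enumerated in [bitseqs_affine_preimage], and its entry in the
    table supplies the palette and the coefficients of [f]. *)
Lemma five_colors_affine (S : {set 'Z_11}) : #|S| = 5%N ->
  exists f : {perm 'Z_11}, coloring_automorphism f /\
    (forall a b c : 'Z_11, 2%:R * b = a + c -> 2%:R * f b = f a + f c) /\
    exists2 r, r \in palettes & forall x, (x \in S) = (val (f x) \in r).
Proof.
move=> cardS; pose m := [seq inZp i \in S | i <- iota 0 11].
have val_Z11 : [seq val x | x <- enum 'Z_11] = iota 0 11 by exact: val_enum_ord.
have mE : m = [seq x \in S | x <- enum 'Z_11].
  rewrite /m -val_Z11 -map_comp; apply: eq_map => x /=.
  by rewrite valZpK.
have : m \in bitseqs 11 by have := mem_bitseqs m; rewrite size_map.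
move/(allP bitseqs_affine_preimage); rewrite {1}mE count_map.
have -> : count (preim (fun x => x \in S) id) (enum 'Z_11) = 5%N.
  by apply: etrans cardS; rewrite cardE [in RHS]/enum_mem size_filter enumT.
move=> /flatten_mapP[r r_pal] /allpairsP[[l k] /= [l_mem k_mem em]].
exists (affine_perm k l_mem); split; first exact: affine_perm_automorphism.
split.
  move=> a b c e; rewrite !affine_permE.
  have -> : 2%:R * (l%:R * b + k%:R) = l%:R * (2%:R * b) + 2%:R * k%:R :> 'Z_11.
    by ring.
  by rewrite e; ring.
exists r => // x; rewrite val_affine_perm.
have ltx : (val x < 11)%N := ltn_ord x.
(* Equality of the two masks, read at bit [val x], is the required equivalence for [x]. *)
have := congr1 (fun s => nth false s (val x)) em.
rewrite /m !(nth_map 0%N) ?size_iota // !nth_iota // !add0n => <-.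
by rewrite valZpK.
Qed.

Lemma equivalent_color_sets_palette (S : {set 'Z_11}) (f : {perm 'Z_11})
    (r : seq nat) :
  coloring_automorphism f -> (forall x, (x \in S) = (val (f x) \in r)) ->
  equivalent_color_sets S [set y : 'Z_11 | val y \in r].
Proof.
move=> f_aut Sr; exists f => //; apply/setP=> y.
by rewrite -[y](permKV f) mem_imset ?Sr ?inE //; apply: perm_inj.
Qed.

Theorem theorem12 (L : link) (S : {set 'Z_11}) :
  colorable 11 L ->
  link_det L <> 0%N ->
  (exists2 D : diagram, diagram_of D L
     & exists2 c : diagram_arc D -> 'Z_11, coloring c /\ nontrivial c
         & forall a : diagram_arc D, c a \in S) ->
  #|S| = 5%N ->
  equivalent_color_sets S [set 0; 1; 2%:R; 3%:R; 6%:R]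
  \/ equivalent_color_sets S [set 0; 1; 2%:R; 4%:R; 7%:R].
Proof.
move=> _ detL [D DL [c [c_col [a [b cab]]] cS]].
case/five_colors_affine=> f [f_aut [f_affine [r + Sr]]].
have equivS := equivalent_color_sets_palette f_aut Sr.
rewrite 2!inE => /or3P[/eqP er|/eqP er|/mapP[rv rv_pal er]].
- left; rewrite er in equivS; congr equivalent_color_sets: equivS.
  by apply/setP=> -[[|[|[|[|[|[|[|[|[|[|[|//]]]]]]]]]]] lt]; rewrite !inE.
- right; rewrite er in equivS; congr equivalent_color_sets: equivS.
  by apply/setP=> -[[|[|[|[|[|[|[|[|[|[|[|//]]]]]]]]]]] lt]; rewrite !inE.
(* For the four other palettes, composing [c] with [f] and the lift gives an integer coloring,
   non-constant by injectivity, so the determinant vanishes. *)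
case: detL; have [lift_inj lift_mid] := lifted_palettesP rv_pal.
have in_r d : val (f (c d)) \in rv.1 by rewrite -er -Sr.
apply: (link_det_eq0 (c := fun d => lift_color rv (f (c d))) DL).
  by move=> t; apply: lift_mid => //; apply: f_affine; apply: c_col.
by exists a, b => /lift_inj e; apply/cab/(@perm_inj _ f)/e.
Qed.
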